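(* Let $\lambda$ be a cardinal with $\lambda<\mathfrak s$. Then every sequentially compact Hausdorff space $X$ with $\mathrm{cHw}(X)<\mathfrak s$ is $\lambda$-ssc.
   Context: $[\omega]^\omega$ is the set of all infinite subsets of $\omega$. A sequence $x=\langle x_n:n<\omega\rangle$ converges along $H\in[\omega]^\omega$ if the subsequence $\langle x_n:n\in H\rangle$ converges. A space $X$ is $\lambda$-simultaneously sequentially compact ($\lambda$-ssc) if for any $\lambda$-many sequences with values in $X$ there is $H\in[\omega]^\omega$ such that each of those sequences converges along $H$. A family $\mathcal S\subseteq[\omega]^\omega$ is splitting if for every $A\in[\omega]^\omega$ there is $S\in\mathcal S$ with $A\cap S$ and $A\setminus S$ both infinite; $\mathfrak s$ is the least cardinality of a splitting family. For $Y\subseteq X$, $\mathcal L(Y)$ is the set of all $p\in X$ such that some sequence in $Y$ converges to $p$, and $\mathrm{SeqCl}(Y)$ is the smallest sequentially closed subset of $X$ containing $Y$. A sequentially separating limit cover for $Y$ is a family $\mathcal C_Y$ of open subsets of $\mathcal L(Y)$ (with the subspace topology) such that for each $p\in\mathcal L(Y)$ and each $q\in X$ with $q\ne p$ there is $U\in\mathcal C_Y$ with $p\in U$ and $q\notin\mathrm{SeqCl}(U)$. For a Hausdorff space $X$, the countable Hausdorff weight $\mathrm{cHw}(X)$ is the least infinite cardinal $\kappa$ such that each countable $Y\subseteq X$ admits a sequentially separating limit cover $\mathcal C_Y$ with $|\mathcal C_Y|\le\kappa$. *)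

(* Defs.v *)
From HB Require Import structures.
From mathcomp Require Import all_boot all_order.
From mathcomp Require Import all_classical.
From mathcomp Require Import topology.

Set Implicit Arguments.
Unset Strict Implicit.
Unset Printing Implicit Defensive.

Local Open Scope classical_set_scope.
Local Open Scope card_scope.

(* A cardinal is represented by any set of that cardinality. *)

Definition card_lt (T U : Type) (A : set T) (B : set U) : Prop :=
  A #<= B /\ ~ (B #<= A).

Notation "A '#<' B" := (card_lt A B)
  (at level 79, format "A  '#<'  B") : card_scope.

Lemma card_min (T : Type) (F : set (set T)) :
  F !=set0 -> exists2 A, F A & forall B, F B -> A #<= B.
Proof.
move=> [A0 FA0].
pose P (G : set (set T -> T)) :=
  (forall f, G f -> forall A, F A -> A (f A)) /\
  (forall f g, G f -> G g -> forall A, F A -> f A = g A -> f = g).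
have [G [[GF Ginj] Gmax]] : exists G, P G /\ forall G', G `<` G' -> ~ P G'.
  apply: Zorn_bigcup => C CP Ctot; split.
    by move=> f [G CG Gf]; apply: (CP _ CG).1.
  move=> f g [G CG Gf] [G' CG' Gg].
  have [GG'|G'G] := Ctot _ _ CG CG'.
    by apply: (CP _ CG').2 => //; exact: GG'.
  by apply: (CP _ CG).2 => //; exact: G'G.
have [[A FA AG]|noA] :=
  pselect (exists2 A, F A & A `<=` (fun f : set T -> T => f A) @` G).
  exists A => // B FB.
  apply: card_le_trans (subset_card_le AG) _.
  apply: card_le_trans (card_image_le _ _) _.
  have GE : (fun f : set T -> T => f B) @` G #= G.
    by apply: inj_card_eq => f g /set_mem Gf /set_mem Gg; apply: Ginj.
  rewrite -(card_le_eql GE); apply: subset_card_le => _ [f Gf <-]; exact: (GF f Gf B FB).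
have ext A : F A -> exists t, A t /\ forall g, G g -> g A <> t.
  move=> FA; apply: contrapT => nt; apply: noA; exists A => // t At.
  apply: contrapT => ntG; apply: nt; exists t; split => // g Gg gt.
  by apply: ntG; exists g.
have [t0 _] := ext _ FA0.
have /choice[h hP] : forall A, exists t,
    F A -> A t /\ forall g, G g -> g A <> t.
  move=> A; have [FA|nFA] := pselect (F A); last by exists t0.
  by have [t tP] := ext _ FA; exists t.
exfalso; apply: (Gmax (G `|` [set h])).
  split; first by move=> f Gf; left.
  move=> sub; have Gh : G h by apply: sub; right.
  by have [_ /(_ _ Gh)] := hP _ FA0.
split.
  by move=> f [Gf|->] A FA; [exact: (GF f Gf A FA) | exact: (hP _ FA).1].
move=> f g [Gf|->] [Gg|->] A FA // fg.
- exact: (Ginj _ _ Gf Gg _ FA).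
- by have [_ /(_ _ Gf)] := hP _ FA.
- by have [_ /(_ _ Gg)] := hP _ FA; rewrite -fg.
Qed.

Lemma card_le_total (T U : Type) (A : set T) (B : set U) :
  A #<= B \/ B #<= A.
Proof.
have iA : @inl T U @` A #= A by apply: inj_card_eq => x y _ _ [].
have iB : @inr T U @` B #= B by apply: inj_card_eq => x y _ _ [].
have [] := @card_min (T + U)%type [set @inl T U @` A; @inr T U @` B].
  by exists (inl @` A); left.
move=> _ [->|->] /= h; [left|right].
  by have := h _ (or_intror erefl); rewrite (card_le_eql iA) (card_le_eqr iB).
by have := h _ (or_introl erefl); rewrite (card_le_eql iB) (card_le_eqr iA).
Qed.

Definition splitting (S : set (set nat)) : Prop :=
  (forall B, S B -> infinite_set B) /\
  (forall A, infinite_set A ->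
     exists2 B, S B & infinite_set (A `&` B) /\ infinite_set (A `\` B)).

Definition is_splitting_number (k : set (set nat)) : Prop :=
  splitting k /\ forall S, splitting S -> k #<= S.

(* The cardinal s, as a splitting family of least cardinality; the default
   value of [xget] is not used, by [splitting_numberP]. *)
Definition splitting_number : set (set nat) := xget set0 is_splitting_number.

Lemma splitting_infinite_set : splitting [set B : set nat | infinite_set B].
Proof.
split=> // A /infiniteP /pcard_leP[f].
have finj : injective f by move=> m n; apply: inj; rewrite in_setT.
have im (g : nat -> nat) : injective g ->
    infinite_set ((fun n => f (g n)) @` setT).
  move=> ginj; apply/infiniteP.
  have E : (fun n => f (g n)) @` setT #= [set: nat].
    by apply: inj_card_eq => m n _ _ /finj /ginj.
  by rewrite (card_le_eqr E).
have dinj : injective double by exact: double_inj.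
have sdinj : injective (fun n => n.*2.+1) by move=> m n [] /double_inj.
have fA n : A (f n) by apply: funS.
exists ((fun n => f n.*2) @` setT); first exact: (im _ dinj).
split.
  apply: sub_infinite_set (im _ dinj) => _ [n _ <-]; split; first exact: fA.
  by exists n.
apply: sub_infinite_set (im _ sdinj) => _ [n _ <-]; split; first exact: fA.
by move=> [m _ /finj mn]; have := congr1 odd mn; rewrite /= !odd_double.
Qed.

Lemma splitting_numberP : is_splitting_number splitting_number.
Proof.
rewrite /splitting_number; case: xgetP => // none; exfalso.
have [] := @card_min (set nat) splitting.
  by exists [set B | infinite_set B]; exact: splitting_infinite_set.
by move=> k sk kmin; apply: (none k).
Qed.

Section spaces.
Variable X : topologicalType.
Implicit Types (H : set nat) (x : nat -> X) (Y U : set X).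

Definition converges_along H x : Prop :=
  exists p : X, x @ within H \oo --> p.

Definition simultaneously_seq_compact (L : Type) : Prop :=
  forall x : L -> nat -> X,
    exists2 H, infinite_set H & forall l, converges_along H (x l).

Definition seq_compact : Prop :=
  forall x, exists2 H, infinite_set H & converges_along H x.

Definition seq_limits Y : set X :=
  [set p | exists2 x : nat -> X, (forall n, Y (x n)) & x @ \oo --> p].

Definition seq_closed Y : Prop := seq_limits Y `<=` Y.

Definition seq_closure Y : set X := smallest seq_closed Y.

Definition relatively_open Y U : Prop := exists2 V, open V & U = V `&` Y.

(* The sequential closure of [U] is taken in [X], not in [seq_limits Y]. *)
Definition seq_separating_limit_cover Y (C : set (set X)) : Prop :=
  (forall U, C U -> relatively_open (seq_limits Y) U) /\
  (forall p q, seq_limits Y p -> q <> p ->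
     exists2 U, C U & U p /\ ~ seq_closure U q).

Definition cHw_bound (T : Type) (k : set T) : Prop :=
  infinite_set k /\
  forall Y, countable Y ->
    exists2 C, seq_separating_limit_cover Y C & C #<= k.

Definition is_cHw (T : Type) (k : set T) : Prop :=
  cHw_bound k /\ forall (U : Type) (k' : set U), cHw_bound k' -> k #<= k'.

(* The carrier [nat + set X] is large enough to contain a set of cardinality
   cHw(X); the default value of [xget] is not used when X is Hausdorff, by
   [cHwP]. *)
Definition cHw : set (nat + set X) := xget set0 (@is_cHw (nat + set X)).

Lemma cHw_bound_le (T U : Type) (k : set T) (k' : set U) :
  k #<= k' -> cHw_bound k -> cHw_bound k'.
Proof.
move=> kk' [kinf kb]; split.
  by apply/infiniteP; apply: card_le_trans kk'; apply/infiniteP.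
by move=> Y /kb[C CY Ck]; exists C => //; apply: card_le_trans kk'.
Qed.

Lemma cHw_boundT : hausdorff_space X -> cHw_bound [set: nat + set X].
Proof.
move=> hX; split.
  apply/infiniteP.
  have E : @inl nat (set X) @` setT #= [set: nat].
    by apply: inj_card_eq => x y _ _ [].
  rewrite -(card_le_eql E); exact: subset_card_le.
move=> Y _; exists [set U | relatively_open (seq_limits Y) U]; last first.
  apply: card_le_trans (card_leT _) _.
  have E : @inr nat (set X) @` setT #= [set: set X].
    by apply: inj_card_eq => x y _ _ [].
  rewrite -(card_le_eql E); exact: subset_card_le.
split => // p q Lp /eqP; rewrite eq_sym => pq.
move: hX; rewrite open_hausdorff => /(_ _ _ pq)[[V W]] /=.
rewrite !inE => -[Vp Wq] [oV oW VW0].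
exists (V `&` seq_limits Y); first by exists V.
split => // /(_ (~` W)); apply => //; split; last first.
  by move=> z [Vz _] Wz; have : (V `&` W) z by []; rewrite VW0.
move=> r [x xW xr] Wr.
have [N _ /(_ N (leqnn _))] := xr _ (open_nbhs_nbhs (conj oW Wr)).
exact: xW.
Qed.

Lemma cHwP : hausdorff_space X -> is_cHw cHw.
Proof.
move=> hX; rewrite /cHw; case: xgetP => // none; exfalso.
have [] := @card_min _ [set k : set (nat + set X) | cHw_bound k].
  by exists setT; exact: cHw_boundT.
move=> k kb kmin; apply: (none k); split => // U k' k'b.
have [kT|Tk'] := card_le_total k' [set: nat + set X]; last first.
  by apply: card_le_trans Tk'; exact: card_leT.
have /card_leP[g] := kT.
pose k'' := (fun t => set_val (g t)) @` [set: k'].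
have k''k' : k'' #= k'.
  apply: card_eq_trans (card_setT k').
  by apply: inj_card_eq => s t _ _ /val_inj; apply: inj; rewrite in_setT.
have /kmin : cHw_bound k''.
  by apply: cHw_bound_le k'b; rewrite (card_le_eqr k''k').
by rewrite (card_le_eqr k''k').
Qed.

End spaces.

Arguments simultaneously_seq_compact : clear implicits.
Arguments seq_compact : clear implicits.
Arguments cHw : clear implicits.

(* Main.v *)
Require Import Defs.
From mathcomp Require Import all_boot all_order.
From mathcomp Require Import all_classical topology.

(** The smallness of lambda and of cHw(X) is used once, to find one set H of
    indices that no relevant set of indices splits; after that the sequences
    are treated separately.

    Let x^l, for l in L, be the given sequences, and let C_l be a sequentially
    separating limit cover for the range of x^l with at most cHw(X) members.
    The sets {n | x^l_n in U}, for l in L and U in C_l, number at most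
    lambda * cHw(X), hence at most the larger of the two factors, as cHw(X) is
    infinite ([card_bigcup_le]), and thus fewer than s.  So no splitting family
    lies among them, and some infinite H is almost contained in, or almost
    disjoint from, each of them ([unsplit_of_card_lt]).

    Each x = x^l converges along this H ([converges_along_unsplit]).
    Sequential compactness gives an infinite G inside H along which x converges
    to some p.  If x did not converge to p along H, infinitely many indices of H
    would send x outside some neighbourhood of p, and sequential compactness
    would give an infinite B inside H along which x converges to some q <> p.
    Take U in C_l with p in U and q outside SeqCl(U).  As U is open in the limit
    set, x is eventually in U along G; as H is not split, x is then eventually
    in U along H, and so along B; thus q lies in SeqCl(U), a contradiction.

    The cardinal arithmetic rests on Hessenberg's theorem K * K <= K for
    infinite K ([card_setX_infinite]), proved by Zorn's lemma. *)

Local Open Scope classical_set_scope.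
Local Open Scope card_scope.

(** * Arithmetic of infinite cardinals *)

Definition inj_into {T U : Type} (A : set T) (B : set U) (f : T -> U) : Prop :=
  (forall a, A a -> B (f a)) /\
  (forall a a', A a -> A a' -> f a = f a' -> a = a').

Lemma card_le_of_inj {T U : Type} {A : set T} {B : set U} (f : T -> U) :
  inj_into A B f -> A #<= B.
Proof.
move=> [fAB finj].
have fE : f @` A #= A.
  by apply: inj_card_eq => a a' /set_mem Aa /set_mem Aa'; exact: finj.
by rewrite -(card_le_eql fE); apply: subset_card_le => _ [a Aa <-]; exact: fAB.
Qed.

(** Nonemptiness of the codomain provides the values of a total function
    outside of its domain of interest. *)
Lemma inj_of_card_le {T U : Type} {A : set T} {B : set U} :
  B !=set0 -> A #<= B -> exists f, inj_into A B f.
Proof.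
elim/Ppointed: U B => U B; first by move=> [b _]; case: (no b).
move=> _ /pcard_leP/injfunPex[f fAB finj]; exists f; split => // a a' Aa Aa'.
by apply: finj; apply/mem_set.
Qed.

Lemma infinite_seq {T : Type} (A : set T) :
  infinite_set A -> exists2 f : nat -> T, injective f & forall n, A (f n).
Proof.
move=> Ainf; have [f [fA finj]] := inj_of_card_le (infinite_setN0 Ainf)
  ((infiniteP A).1 Ainf).
by exists f => [m n|n]; [exact: finj | exact: fA].
Qed.

Lemma infinite_card_ge {T U : Type} {A : set T} {B : set U} :
  A #<= B -> infinite_set A -> infinite_set B.
Proof.
by move=> AB /infiniteP Ainf; apply/infiniteP; apply: card_le_trans AB.
Qed.

(** The union embeds in K * K: one coordinate tags, by two fixed points of K,
    the set that a point is taken from. *)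
Lemma square_card_setU {T U : Type} (K : set T) (D E : set U) :
  infinite_set K -> K `*` K #<= K -> D #<= K -> E #<= K -> D `|` E #<= K.
Proof.
move=> Kinf KK DK EK; apply: card_le_trans KK.
have [a ainj aK] := infinite_seq K Kinf.
have [d [dK dinj]] := inj_of_card_le (infinite_setN0 Kinf) DK.
have [e [eK einj]] := inj_of_card_le (infinite_setN0 Kinf) EK.
apply: (card_le_of_inj
  (fun x => if `[< D x >] then (a 0, d x) else (a 1, e x))); split => [x|x y].
  case: asboolP => [Dx _|nDx [//|Ex]]; split; [exact: aK|exact: dK|exact: aK|].
  exact: eK.
case: asboolP => [Dx|nDx]; case: asboolP => [Dy|nDy].
- by move=> _ _ [/dinj]; exact.
- by move=> _ _ [/ainj].
- by move=> _ _ [/ainj].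
- by move=> [//|Ex] [//|Ey] [/einj]; exact.
Qed.

(** Hessenberg's theorem.  Order by extension the pairs of an infinite subset
    A of K and an injection of A * A into A; countable subsets provide a first
    pair.  Let (A, f) be maximal.  If K \ A is no larger than A, then K is no
    larger than A, which is enough.  Otherwise K \ A contains a copy g(A) of
    A, and f extends to an injection for B = A + g(A): the new pairs, those in
    B * B but not in A * A, go injectively to g(A), because B is no larger than
    A.  This contradicts maximality. *)
Lemma card_setX_infinite {T : Type} (K : set T) :
  infinite_set K -> K `*` K #<= K.
Proof.
move=> Kinf; have [k0 Kk0] := infinite_setN0 Kinf.
pose good (p : set T * (T * T -> T)) :=
  [/\ p.1 `<=` K, infinite_set p.1 & inj_into (p.1 `*` p.1) p.1 p.2].
pose le (p q : {p | good p}) := (sval p).1 `<=` (sval q).1 /\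
  forall u, ((sval p).1 `*` (sval p).1) u -> (sval p).2 u = (sval q).2 u.
pose R p q := `[< le p q >].
have [k kinj kK] := infinite_seq K Kinf.
pose A0 := range k.
have A0inf : infinite_set A0.
  apply/infiniteP.
  by apply: (card_le_of_inj k); split => [n _|m n _ _ /kinj //]; exists n.
have A0A0 : A0 `*` A0 #<= A0.
  apply: card_le_trans ((infiniteP A0).1 A0inf).
  by apply: countableX; exact: card_image_le.
have [f0 f0P] := inj_of_card_le (infinite_setN0 A0inf) A0A0.
have good0 : good (A0, f0) by split => // _ [n _ <-]; exact: kK.
have [||C Ctot|p max] := @ZL_preorder _ (exist good _ good0) R.
- by move=> p; apply/asboolP; split.
- move=> r s t /asboolP[rs rsE] /asboolP[st stE]; apply/asboolP; split.
    exact: subset_trans st.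
  move=> u ru; rewrite rsE// stE//; case: ru => ? ?; split; exact: rs.
- have [[p0 Cp0]|C0] := pselect (C !=set0); last first.
    by exists (exist good _ good0) => p Cp; case: C0; exists p.
  pose B := [set a | exists2 p, C p & (sval p).1 a].
  have common p q : C p -> C q -> exists r, [/\ C r, le p r & le q r].
    move=> Cp Cq; have lexx t : le t t by split.
    by have [/asboolP|/asboolP] := Ctot _ _ Cp Cq => ?; [exists q|exists p].
  (* by the previous fact the injections of the members agree where they are
     relevant, so that a single function g extends all of them *)
  have /choice[g gE] : forall u, exists c, forall p, C p ->
      ((sval p).1 `*` (sval p).1) u -> c = (sval p).2 u.
    move=> u.
    have [[p Cp pu]|np] := pselect
      (exists2 p, C p & ((sval p).1 `*` (sval p).1) u); last first.
      by exists k0 => p Cp pu; case: np; exists p.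
    exists ((sval p).2 u) => q Cq qu.
    by have [r [_ [_ pr] [_ qr]]] := common _ _ Cp Cq; rewrite pr// qr.
  have sq u : (B `*` B) u -> exists2 p, C p & ((sval p).1 `*` (sval p).1) u.
    move=> [[p Cp pu] [q Cq qu]].
    by have [r [Cr [pr _] [qr _]]] := common _ _ Cp Cq; exists r => //; split;
       [exact: pr|exact: qr].
  have goodB : good (B, g).
    split => /=.
    - by move=> a [p _]; case: (svalP p) => + _ _; exact.
    - apply: sub_infinite_set (_ : (sval p0).1 `<=` B) _.
        by move=> a p0a; exists p0.
      by case: (svalP p0).
    - split.
        move=> u /sq[p Cp pu]; rewrite (gE u p)//; exists p => //.
        by case: (svalP p) => _ _ [+ _]; exact.
      move=> u v /sq[p Cp pu] /sq[q Cq qv].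
      have [r [Cr [pr _] [qr _]]] := common _ _ Cp Cq.
      have ru : ((sval r).1 `*` (sval r).1) u.
        by case: pu => ? ?; split; exact: pr.
      have rv : ((sval r).1 `*` (sval r).1) v.
        by case: qv => ? ?; split; exact: qr.
      rewrite (gE u r)// (gE v r)//.
      by case: (svalP r) => _ _ [_]; exact.
  exists (exist good _ goodB) => p Cp; apply/asboolP; split => /=.
    by move=> a pa; exists p.
  by move=> u pu; rewrite (gE u p).
have [AK Ainf fP] := svalP p; set A := (sval p).1 in AK Ainf fP.
set f := (sval p).2 in fP.
have AA : A `*` A #<= A by exact: card_le_of_inj fP.
have [KA|AD] := card_le_total (K `\` A) A.
  have {}KA : K #<= A.
    rewrite -(setDUK AK); exact: square_card_setU.
  have [h [hA hinj]] := inj_of_card_le (infinite_setN0 Ainf) KA.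
  apply: card_le_trans (subset_card_le AK); apply: card_le_trans AA.
  apply: (card_le_of_inj (fun u => (h u.1, h u.2))); split.
    by move=> [x y] [Kx Ky]; split; exact: hA.
  move=> [x y] [x' y'] [Kx Ky] [Kx' Ky'] [hx hy].
  by rewrite (hinj x x')// (hinj y y').
have [a Aa] := infinite_setN0 Ainf.
have [g [gD ginj]] : exists g, inj_into A (K `\` A) g.
  apply: (inj_of_card_le _ AD); apply: infinite_setN0.
  exact: infinite_card_ge AD Ainf.
pose B := A `|` g @` A.
have BA : B #<= A.
  apply: square_card_setU => //; exact: card_image_le.
have [h [hA hinj]] := inj_of_card_le (infinite_setN0 Ainf) BA.
(* through h, the square of B is as small as that of A, and g moves it off A *)
pose f' u := if `[< (A `*` A) u >] then f u else g (f (h u.1, h u.2)).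
have hhA u : (B `*` B) u -> A (f (h u.1, h u.2)).
  by move=> [Bx By]; apply: fP.1; split; exact: hA.
have goodB : good (B, f').
  split=> /=.
  - by move=> x [/AK//|[y Ay <-]]; exact: (gD y Ay).1.
  - by apply: sub_infinite_set Ainf => x; left.
  - split; rewrite /f'.
      move=> u uB; case: asboolP => [uA|nuA]; first by left; exact: fP.1.
      by right; exists (f (h u.1, h u.2)) => //; exact: hhA.
    move=> u v uB vB; case: asboolP => uA; case: asboolP => vA.
    + exact: fP.2.
    + by move=> E; have [_] := gD _ (hhA _ vB); rewrite -E; case; exact: fP.1.
    + by move=> E; have [_] := gD _ (hhA _ uB); rewrite E; case; exact: fP.1.
    + move/(ginj _ _ (hhA _ uB) (hhA _ vB)).
      move: u v uB vB {uA vA} => [x y] [x' y'] [Bx By] [Bx' By'] E.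
      have [hx hy] : (h x, h y) = (h x', h y').
        by apply: fP.2 E; split; exact: hA.
      by rewrite (hinj x x')// (hinj y y').
have /asboolP[/= BsubA _] : R (exist good _ goodB) p.
  apply: max; apply/asboolP; split => /=; first by move=> x; left.
  by move=> u uA; rewrite /f'; case: asboolP.
have [_] := gD _ Aa; case; apply: BsubA; right; by exists a.
Qed.

(** Choosing for each point of the union an index of a set that contains it
    embeds the union in K * K. *)
Lemma card_bigcup_le {I T U : Type} (K : set U) (D : set I) (F : I -> set T) :
  infinite_set K -> D #<= K -> (forall i, D i -> F i #<= K) ->
  \bigcup_(i in D) F i #<= K.
Proof.
move=> Kinf DK FK; have K0 := infinite_setN0 Kinf.
have [[i0 Di0]|D0] := pselect (D !=set0); last first.
  suff -> : \bigcup_(i in D) F i = set0 by [].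
  by rewrite -subset0 => x [i Di _]; apply: D0; exists i.
have [d [dK dinj]] := inj_of_card_le K0 DK.
have [k0 Kk0] := K0.
have /choice[e eP] : forall i, exists f, D i -> inj_into (F i) K f.
  move=> i; have [Di|nDi] := pselect (D i); last by exists (fun=> k0).
  by have [f] := inj_of_card_le K0 (FK i Di); exists f.
have /choice[j jP] : forall x, exists i,
    (\bigcup_(i in D) F i) x -> D i /\ F i x.
  move=> x; have [[i Di Fix]|nx] := pselect ((\bigcup_(i in D) F i) x).
    by exists i.
  by exists i0.
apply: card_le_trans (card_setX_infinite K Kinf).
apply: (card_le_of_inj (fun x => (d (j x), e (j x) x))); split.
  by move=> x /jP[Dj Fj]; split; [exact: dK|exact: (eP _ Dj).1].
move=> x y /jP[Djx Fjx] /jP[Djy Fjy] [/(dinj _ _ Djx Djy) jxy].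
by rewrite -jxy in Fjy *; exact: (eP _ Djx).2.
Qed.

(** * Families smaller than the splitting number *)

(** A splitting family consists of infinite sets; discarding the finite members
    of S is harmless since a finite set splits nothing. *)
Lemma unsplit_of_card_lt {S : set (set nat)} :
  S #< splitting_number ->
  exists2 H, infinite_set H &
    forall A, S A -> finite_set (H `&` A) \/ finite_set (H `\` A).
Proof.
move=> [_ Slt]; apply: contrapT => none; apply: Slt.
pose S' := [set A | S A /\ infinite_set A].
have /splitting_numberP.2 S's : splitting S'.
  split=> [A [_ //]|H Hinf].
  apply: contrapT => nosplit; apply: none; exists H => // A SA.
  apply: contrapT => /not_orP[HA HnA]; apply: nosplit; exists A => //.
  by split => //; apply: sub_infinite_set HA => n [].
by apply: card_le_trans S's _; apply: subset_card_le => A [].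
Qed.

(** * Convergence along a set of indices *)

Section convergence_along.
Variable X : topologicalType.
Implicit Types (H G : set nat) (x : nat -> X) (Y U Z : set X) (p : X).

Lemma near_finite_setC (F : set nat) :
  finite_set F -> \forall n \near \oo, ~ F n.
Proof.
move=> /finite_seqP[s ->]; elim: s => [|m s IHs]; first exact: nearW.
apply: filterS2 IHs (nbhs_infty_gt m) => n ns mn /=.
by rewrite inE => /orP[/eqP nm|//]; rewrite nm ltnn in mn.
Qed.

Lemma near_infinite_set H (P : set nat) :
  infinite_set H -> (\forall n \near \oo, P n) -> infinite_set (H `&` P).
Proof.
move=> Hinf [N _ NP]; apply: sub_infinite_set
  (infinite_setD Hinf (finite_II N)).
by move=> n [Hn /negP]; rewrite -leqNgt => /NP.
Qed.

Lemma inj_cvg_infty (f : nat -> nat) : injective f -> f @ \oo --> \oo.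
Proof.
move=> finj V [N _ NV].
have fN : finite_set (f @^-1` `I_N).
  by apply: finite_preimage (finite_II N) => m n _ _; exact: finj.
apply: filterS (near_finite_setC _ fN) => n /= /negP.
by rewrite -leqNgt => /NV.
Qed.

(** The link between limits along a set of indices and limits of sequences: an
    injective, not necessarily increasing, enumeration of infinitely many good
    indices is enough, because an injection of nat tends to infinity. *)
Lemma seq_limits_along {H x p Z} : infinite_set H ->
  x @ within H \oo --> p -> (\forall n \near \oo, H n -> Z (x n)) ->
  seq_limits Z p.
Proof.
move=> Hinf xp xZ.
have [f finj fHZ] := infinite_seq _ (near_infinite_set _ _ Hinf xZ).
exists (x \o f) => [n|V /xp]; first by case: (fHZ n) => Hf; exact.
move=> /(inj_cvg_infty _ finj); rewrite /nbhs /=.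
by apply: filterS => n; apply; case: (fHZ n).
Qed.

Lemma seq_limits_sub_closure U : seq_limits U `<=` seq_closure U.
Proof.
move=> q [x xU xq] Z [Zcl UZ]; apply: Zcl; exists x => // n; exact: UZ.
Qed.

Lemma seq_compact_along H x : seq_compact X -> infinite_set H ->
  exists G, [/\ infinite_set G, G `<=` H & converges_along G x].
Proof.
move=> scX Hinf; have [f finj fH] := infinite_seq H Hinf.
have [G Ginf [p xfp]] := scX (x \o f).
have fGinf : infinite_set (f @` G).
  apply: infinite_card_ge Ginf; apply: (card_le_of_inj f).
  by split => [n Gn|m n _ _ /finj //]; exists n.
exists (f @` G); split => //; first by move=> _ [n _ <-].
exists p => V /xfp [N _ NV].
have := near_finite_setC _ (finite_image f (finite_II N)).
rewrite /nbhs /= /within /=; apply: filterS => m + [n Gn nm].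
rewrite -nm => nfN.
apply: NV => //=; rewrite leqNgt; apply/negP => nN; apply: nfN.
by exists n.
Qed.

(** If x has two limits p and q along infinite subsets of H, a member U of the
    cover that separates p from q has a preimage under x that splits H, or
    else it captures q in its sequential closure. *)
Lemma converges_along_unsplit H Y C x :
  hausdorff_space X -> seq_compact X -> infinite_set H ->
  (forall n, Y (x n)) -> seq_separating_limit_cover Y C ->
  (forall U, C U -> finite_set (H `&` x @^-1` U) \/
                    finite_set (H `\` x @^-1` U)) ->
  converges_along H x.
Proof.
move=> hX scX Hinf xY [Copen Csep] unsplit.
have [G [Ginf GH [p xGp]]] := seq_compact_along H x scX Hinf.
exists p => V Vp; apply: contrapT => nHV.
have Lx n : seq_limits Y (x n) by exists (fun=> x n) => //; exact: cvg_cst.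
have Lp : seq_limits Y p.
  by apply: (seq_limits_along Ginf xGp); apply: nearW => n _; exact: xY.
have Binf : infinite_set (H `&` [set n | ~ V (x n)]).
  move/near_finite_setC => nearV; apply: nHV.
  rewrite /nbhs /= /within /=; apply: filterS nearV => n nn Hn.
  by apply: contrapT => nV; exact: nn.
have [B' [B'inf B'B [q xq]]] := seq_compact_along _ x scX Binf.
have qp : q <> p.
  move=> qp; rewrite qp in xq; have := xq _ Vp.
  rewrite /nbhs /= /within /= => B'V.
  have [n [B'n xnV]] := infinite_setN0 (near_infinite_set _ _ B'inf B'V).
  by have [_] := B'B _ B'n; apply; exact: xnV.
have [U CU [Up nUq]] := Csep _ _ Lp qp.
have [W oW UE] := Copen _ CU.
have GU : \forall n \near \oo, G n -> U (x n).
  have : nbhs p W.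
    by apply: open_nbhs_nbhs; split => //; move: Up; rewrite UE => -[].
  move=> /xGp; rewrite /nbhs /= /within /=; apply: filterS => n GW Gn.
  by rewrite UE; split => //; exact: GW.
apply: nUq; apply: seq_limits_sub_closure.
apply: (seq_limits_along B'inf xq).
case: (unsplit _ CU) => [fin|/near_finite_setC].
  have := near_infinite_set _ _ Ginf GU; case.
  by apply: sub_finite_set fin => n [Gn GUn]; split; [exact: GH|exact: GUn].
apply: filterS => n nHU B'n; apply: contrapT => nU; apply: nHU; split => //.
by case: (B'B _ B'n).
Qed.

End convergence_along.

Theorem theorem3p5 (L : Type) (hL : [set: L] #< splitting_number)
    (X : topologicalType) (hX : hausdorff_space X) (hsc : seq_compact X)
    (hcHw : cHw X #< splitting_number) :
  simultaneously_seq_compact X L.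
Proof.
have [[cinf cbound] _] := cHwP hX.
move=> x.
have /choice[C CP] : forall l, exists C,
    seq_separating_limit_cover (range (x l)) C /\ C #<= cHw X.
  move=> l; have [|C] := cbound (range (x l)); first exact: card_image_le.
  by exists C.
(* K is the larger of L and cHw(X); it is infinite although L may be finite *)
have [U [K [Kinf [LK cK Klt]]]] : exists (U : Type) (K : set U),
    infinite_set K /\ [/\ [set: L] #<= K, cHw X #<= K & K #< splitting_number].
  have [Lc|cL] := card_le_total [set: L] (cHw X).
    by exists _, (cHw X); split => //; split => //; exact: card_lexx.
  exists L, setT; split; first exact: infinite_card_ge cL cinf.
  by split => //; exact: card_lexx.
pose S := \bigcup_(l in [set: L]) ((fun V => x l @^-1` V) @` C l).
have SK : S #<= K.
  apply: card_bigcup_le => // l _; apply: card_le_trans (card_image_le _ _) _.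
  exact: card_le_trans (CP l).2 cK.
have Slt : S #< splitting_number.
  split; first exact: card_le_trans SK Klt.1.
  by move=> sS; apply: Klt.2; exact: card_le_trans sS SK.
have [H Hinf unsplit] := unsplit_of_card_lt Slt.
exists H => // l.
apply: (converges_along_unsplit _ _ (range (x l)) (C l)) => //.
- exact: (CP l).1.
- by move=> V CV; apply: unsplit; exists l => //; exists V.
Qed.
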